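(* Let $(X,\|\cdot\|)$ be a real reflexive Banach space with dual $X^*$. Let $f:X\to\mathbb{R}$ be fully Legendre and $A:X\to 2^{X^*}$ be maximally monotone. Let $U\subseteq X^*$ be an open subset containing $0$ and let $\Phi,\Psi:U\times X^*\times X^2\to\mathbb{R}$ be two functions. Let $x\in X$ and $\lambda\in(0,\infty)$, and for all $\eta\in U$ denote $$\widetilde{y}(\eta):=(\nabla f+\lambda A)^{-1}\left(\lambda\eta+\nabla f(x)\right),\qquad \widetilde{\xi}(\eta):=\eta-\frac{1}{\lambda}\left(\nabla f(\widetilde{y}(\eta))-\nabla f(x)\right),$$ $$\phi(\eta):=\Phi(\eta,\widetilde{\xi}(\eta),x,\widetilde{y}(\eta)),\qquad \psi(\eta):=\Psi(\eta,\widetilde{\xi}(\eta),x,\widetilde{y}(\eta)),\qquad \theta(\eta):=\psi(\eta)-\phi(\eta).$$ Assume that $\theta$ is lower semicontinuous at $0$ and that $\theta(0)>0$. Then there is $r>0$ such that each $\eta\in X^*$ satisfying $\|\eta\|<r$ belongs to $U$, and for every such $\eta$ there exists a unique pair $(y,\xi)\in X\times X^*$ such that the following three conditions hold: $$\xi\in A(y),\qquad \eta=\xi+\frac{1}{\lambda}\left(\nabla f(y)-\nabla f(x)\right),\qquad \Phi(\eta,\xi,x,y)<\Psi(\eta,\xi,x,y).$$ Moreover, $y=\widetilde{y}(\eta)$ and $\xi=\widetilde{\xi}(\eta)$ for all such $\eta$.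
   Context: A function $f:X\to(-\infty,\infty]$ on a real reflexive Banach space $X$ is called fully Legendre if it is lower semicontinuous, convex and Gâteaux differentiable (hence finite) on all of $X$, and its convex conjugate $f^*:X^*\to(-\infty,\infty]$, $f^*(x^* )=\sup\{\langle x^*,x\rangle-f(x):x\in X\}$, is Gâteaux differentiable (hence finite) on all of $X^*$. Here $\langle x^*,x\rangle=x^*(x)$ and $\nabla f$ is the Gâteaux derivative. A set-valued operator $A:X\to 2^{X^*}$ is monotone if $\langle x_1^*-x_2^*,x_1-x_2\rangle\ge 0$ whenever $x_1^*\in Ax_1$, $x_2^*\in Ax_2$; it is maximally monotone if its graph is not properly contained in the graph of another monotone operator. For $B:X\to 2^{X^*}$, $B^{-1}(w)=\{x\in X:w\in Bx\}$ for $w\in X^*$. Sums of sets are Minkowski sums (empty if one summand is empty), and $(A+B)x=Ax+Bx$, $(\lambda A)(x)=\lambda A(x)$. Under the assumptions here, $(\nabla f+\lambda A)^{-1}(w)$ consists of exactly one point of $X$ for every $w\in X^*$ and is identified with that point. The norm of $\eta\in X^*$ is the dual norm. *)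

(* Defs.v *)
From HB Require Import structures.
From mathcomp Require Import all_boot all_order all_algebra.
From mathcomp Require Import all_classical all_reals all_analysis.

Set Implicit Arguments.
Unset Strict Implicit.
Unset Printing Implicit Defensive.

Import Order.TTheory GRing.Theory Num.Theory.
Import numFieldNormedType.Exports.

Local Open Scope classical_set_scope.
Local Open Scope ring_scope.

Definition continuous_linear (R : realType) (X : normedModType R) :
    {pred X -> R^o} :=
  [pred g : X -> R^o | `[< linear g /\ continuous g >]].

Section dual_submod.
Context (R : realType) (X : normedModType R).

Lemma continuous_linear_submod_closed :
  submod_closed (@continuous_linear R X).
Proof.
split.
  apply/asboolP; split; first by move=> k u v; rewrite /= scaler0 addr0.
  by move=> u; exact: cvg_cst.
move=> k g h /asboolP[lg cg] /asboolP[lh ch]; apply/asboolP; split.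
  move=> a u v; rewrite !fctE /= lg lh !scalerDr !scalerA (mulrC k a).
  by rewrite addrACA.
by move=> u; apply: cvgD; [apply: cvgZl_tmp; exact: cg|exact: ch].
Qed.

HB.instance Definition _ := GRing.isSubmodClosed.Build R (X -> R^o)
  (@continuous_linear R X) continuous_linear_submod_closed.

End dual_submod.

Record dual_space (R : realType) (X : normedModType R) : Type := Dual {
  dual_fun :> X -> R^o ;
  dual_funP : dual_fun \in @continuous_linear R X
}.

Section dual_normed.
Context (R : realType) (X : normedModType R).

HB.instance Definition _ := [isSub for @dual_fun R X].
HB.instance Definition _ := gen_eqMixin (dual_space X).
HB.instance Definition _ := gen_choiceMixin (dual_space X).
HB.instance Definition _ := [SubChoice_isSubLmodule of dual_space X by <:].

Implicit Types eta : dual_space X.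

Lemma dual_linear eta : linear eta.
Proof. by case: eta => g /= /asboolP[]. Qed.

Lemma dual_continuous eta : continuous eta.
Proof. by case: eta => g /= /asboolP[]. Qed.

Lemma dualZ eta a x : eta (a *: x) = a * eta x.
Proof.
have e0 : eta 0 = 0.
  by have := dual_linear eta (-1) 0 0; rewrite scaler0 addr0 scaleN1r addNr.
by have := dual_linear eta a x 0; rewrite !addr0 e0 addr0.
Qed.

Definition dual_norm eta : R :=
  sup [set `|eta x| | x in [set x : X | `|x| <= 1]].

Lemma dual_bounded eta : has_sup [set `|eta x| | x in [set x : X | `|x| <= 1]].
Proof.
split; first by exists `|eta 0|, 0 => //=; rewrite normr0 ler01.
pose l := @GRing.isLinear.Build R X R^o *%R eta (dual_linear eta).
pose g : {linear X -> R^o} := HB.pack (eta : X -> R^o) l.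
have /bounded_funP/(_ 1)[M HM] : bounded_near g (nbhs (0 : X)).
  by apply/linear_bounded_continuous; exact: dual_continuous.
by exists M => _ [x /= x1 <-]; exact: HM.
Qed.

Lemma dual_norm_ub eta x : `|x| <= 1 -> `|eta x| <= dual_norm eta.
Proof.
move=> x1; apply: sup_upper_bound; first exact: dual_bounded.
by exists x.
Qed.

Lemma dual_norm_le eta (M : R) :
  (forall x, `|x| <= 1 -> `|eta x| <= M) -> dual_norm eta <= M.
Proof.
move=> H; apply: ge_sup; first by case: (dual_bounded eta).
by move=> _ [x /= x1 <-]; exact: H.
Qed.

Lemma dual_norm_ge0 eta : 0 <= dual_norm eta.
Proof.
apply: le_trans (normr_ge0 (eta 0)) _.
by apply: dual_norm_ub; rewrite normr0 ler01.
Qed.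

Lemma dual_normD eta1 eta2 :
  dual_norm (eta1 + eta2) <= dual_norm eta1 + dual_norm eta2.
Proof.
apply: dual_norm_le => x x1.
apply: le_trans (ler_normD (eta1 x) (eta2 x)) _.
by apply: lerD; exact: dual_norm_ub.
Qed.

Lemma dual_normZ_le (a : R) eta :
  dual_norm (a *: eta) <= `|a| * dual_norm eta.
Proof.
apply: dual_norm_le => x x1.
have -> : `|(a *: eta) x| = `|a| * `|eta x| by exact: normrM.
by apply: ler_wpM2l => //; exact: dual_norm_ub.
Qed.

Lemma dual_normZ (a : R) eta : dual_norm (a *: eta) = `|a| * dual_norm eta.
Proof.
have [->|a0] := eqVneq a 0.
  rewrite normr0 mul0r; apply/eqP; rewrite eq_le dual_norm_ge0 andbT.
  by have := dual_normZ_le 0 eta; rewrite normr0 mul0r.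
apply/eqP; rewrite eq_le dual_normZ_le /=.
have := dual_normZ_le a^-1 (a *: eta).
rewrite scalerA mulVf// scale1r normfV -ler_pdivrMl ?invr_gt0 ?normr_gt0//.
by rewrite invrK.
Qed.

Lemma dual_norm0_eq0 eta : dual_norm eta = 0 -> eta = 0.
Proof.
move=> n0; apply: val_inj; apply/funext => x /=.
have z y : `|y| <= 1 -> eta y = 0.
  move=> y1; apply/eqP; rewrite -normr_le0 -n0.
  exact: dual_norm_ub.
change (eta x = 0); have [->|x0] := eqVneq x 0.
  by apply: z; rewrite normr0 ler01.
have nx : `|x| != 0 by rewrite normr_eq0.
have := z (`|x|^-1 *: x); rewrite normrZ normfV normr_id mulVf// lexx.
move=> /(_ isT)/eqP; rewrite dualZ mulf_eq0 invr_eq0 (negbTE nx) /=.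
by move/eqP.
Qed.

HB.instance Definition _ := Lmodule_isNormed.Build R (dual_space X)
  dual_normD dual_normZ dual_norm0_eq0.

End dual_normed.

(* [F eta] is the duality pairing of [eta] with the representative of [F]. *)
Definition reflexive_space (R : realType) (X : normedModType R) : Prop :=
  forall F : dual_space (dual_space X), exists x : X, forall eta : dual_space X, F eta = eta x.

Section convex_analysis.
Context (R : realType) (X : normedModType R).

Definition is_gateaux (f : X -> R) (x : X) (eta : dual_space X) : Prop :=
  forall v : X, is_derive x v (f : X -> R^o) (eta v).

Definition gateaux_differentiable (f : X -> \bar R) : Prop :=
  (forall x, f x \is a fin_num) /\
  (forall x, exists eta, is_gateaux (fine \o f) x eta).

(* The value is the junk [0] at points where [f] is not differentiable. *)
Definition gateaux_gradient (f : X -> R) (x : X) : dual_space X :=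
  xget 0 [set eta | is_gateaux f x eta].

Definition convex_conjugate (f : X -> \bar R) (eta : dual_space X) : \bar R :=
  ereal_sup (range (fun x : X => (eta x)%:E - f x)%E).

End convex_analysis.

Definition fully_legendre (R : realType) (X : normedModType R) (f : X -> R) :
    Prop :=
  [/\ lower_semicontinuous (EFin \o f),
      convex_function (setT : set (convex_lmodType X)) f,
      gateaux_differentiable (EFin \o f) &
      gateaux_differentiable (convex_conjugate (EFin \o f))].

Section operators.
Context (R : realType) (X : normedModType R).
Implicit Types A B : X -> set (dual_space X).

Definition graph A : set (X * dual_space X) := [set p | A p.1 p.2].

Definition monotone_operator A : Prop :=
  forall x1 x2 xs1 xs2, A x1 xs1 -> A x2 xs2 -> 0 <= (xs1 - xs2) (x1 - x2).

Definition maximally_monotone A : Prop :=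
  monotone_operator A /\
  forall B, monotone_operator B -> ~ (graph A `<` graph B).

Definition operator_add A B : X -> set (dual_space X) :=
  fun x => [set a + b | a in A x & b in B x].

Definition operator_scale (l : R) A : X -> set (dual_space X) :=
  fun x => [set l *: a | a in A x].

Definition operator_inv A : dual_space X -> set X := fun w => [set x | A x w].

(* [(nabla f + l A)^-1 w] as a point: some element of the set, and the junk
   value [0] should the set be empty. That the set is a singleton is a property
   of [f] and [A], not part of the definition. *)
Definition resolvent (f : X -> R) (l : R) A (w : dual_space X) : X :=
  xget 0 (operator_inv
    (operator_add (fun x => [set gateaux_gradient f x]) (operator_scale l A))
    w).

End operators.

(* Lower semicontinuity at [a] of the restriction of [g] to [U]. *)
Definition lower_semicontinuous_at_in (R : realType) (T : topologicalType)
    (U : set T) (g : T -> R) (a : T) : Prop :=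
  forall c : R, c < g a -> \forall t \near within U (nbhs a), c < g t.

(* Main.v *)
Require Import Defs.
From HB Require Import structures.
From mathcomp Require Import all_boot all_order all_algebra.
From mathcomp Require Import all_classical all_reals all_analysis.
From mathcomp Require Import ring lra.
Import Order.TTheory GRing.Theory Num.Theory.
Import numFieldNormedType.Exports.
Local Open Scope classical_set_scope.
Local Open Scope ring_scope.

(* A solution (y, xi) is a point y with l eta + grad f x in grad f y + l A y,
   plus a strict inequality that holds near eta = 0 by semicontinuity; so
   everything rests on grad f + l A being bijective as a set-valued map.

   Surjectivity (Simons-Zalinescu): after subtracting a functional from f one
   needs 0 in the range of grad f + B. The Fitzpatrick function F of the
   maximally monotone B satisfies F(u, u') >= <u', u>, while
   f(u) + f^*(-u') >= -<u', u>. Hence the value function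
   z |-> inf (F(u, u') + f(u - z1) + f^*(z2 - u')) is convex, finite and
   nonnegative at 0, and has a linear minorant. By the Baire category theorem,
   applied on X and on its dual, the minorant is continuous, so by reflexivity
   it is a pair (u', u) with F(u, u') + f(u) + f^*(-u') <= 0. Equality in the
   two inequalities gives u' in B u and -u' = grad f u.

   Injectivity: monotonicity makes grad f y2 a subgradient of f at y1 as well,
   so y1 and y2 are both subgradients of the differentiable f^* there. *)

(** * Hahn-Banach by maximal cones in [E * R] *)

Section hahn_banach.
Context (R : realType) (E : lmodType R).

(** The last condition keeps the cone on one side over the origin: it is the trace of lying above
    the graph of a linear functional. *)
Definition proper_cone (C : set (E * R)) : Prop :=
  [/\ forall z1 t1 z2 t2, C (z1, t1) -> C (z2, t2) -> C (z1 + z2, t1 + t2),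
      forall (s : R) z t, 0 < s -> C (z, t) -> C (s *: z, s * t) &
      forall t, C (0, t) -> 0 <= t].

Lemma maximal_proper_cone (C : set (E * R)) : proper_cone C ->
  exists M, [/\ C `<=` M, proper_cone M &
    forall N, M `<=` N -> proper_cone N -> N `<=` M].
Proof.
(* Joining [C] to every member makes the empty chain admissible for Zorn's lemma and forces the
   maximal cone to contain [C]. *)
move=> coneC; pose P := [set D | proper_cone (D `|` C)].
have [F FP Ftot|A [PA maxA]] := @Zorn_bigcup _ P.
  have [F0|/set0P[D0 FD0]] := eqVneq F set0.
    by rewrite /P /= F0 bigcup_set0 set0U.
  have lift p : ((\bigcup_(X in F) X) `|` C) p -> exists2 D, F D & (D `|` C) p.
    case=> [[D FD Dp]|Cp]; first by exists D => //; left.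
    by exists D0 => //; right.
  have sub D p : F D -> (D `|` C) p -> ((\bigcup_(X in F) X) `|` C) p.
    by move=> FD [Dp|Cp]; [left; exists D|right].
  split.
  - move=> z1 t1 z2 t2 /lift[D1 FD1 D1p] /lift[D2 FD2 D2p].
    have [D12|D21] := Ftot _ _ FD1 FD2.
      apply: (sub D2) => //; case: (FP _ FD2) => + _ _; apply => //.
      by case: D1p => [/D12|]; [left|right].
    apply: (sub D1) => //; case: (FP _ FD1) => + _ _; apply => //.
    by case: D2p => [/D21|]; [left|right].
  - move=> s z t s0 /lift[D FD Dp]; apply: (sub D) => //.
    by case: (FP _ FD) => _ + _; apply.
  - by move=> t /lift[D FD Dp]; case: (FP _ FD) => _ _; apply.
exists (A `|` C); split => // N AN coneN p Np; apply: contrapT => nAp.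
have CN : C `<=` N by apply: subset_trans AN => ?; right.
apply: (maxA N); last by rewrite /P /= ((setUidPl _ _).2 CN).
split; first by apply: subset_trans AN => ?; left.
by move=> NA; apply: nAp; left; exact: NA.
Qed.

(* Adjoining the ray through [(z, t)] to a maximal cone keeps it closed under
   both operations, hence must create an element [(0, t')] with [t' < 0]. *)
Lemma maximal_cone_dichotomy (M : set (E * R)) z t : proper_cone M ->
  (forall N, M `<=` N -> proper_cone N -> N `<=` M) -> z != 0 ->
  M (z, t) \/ exists2 u : R, u < - t & M (- z, u).
Proof.
move=> [MD MZ M0] maxM z0; apply: contrapT => /not_orP[nM nN].
(* The origin is allowed for [m] separately, since [proper_cone] only gives closure under positive
   scaling. *)
pose N := [set p : E * R | exists m s, [/\ M m \/ m = (0, 0), 0 <= s,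
  p.1 = m.1 + s *: z & p.2 = m.2 + s * t]].
apply/nM/(maxM N); last by exists (0, 0), 1; split=> //=;
  [right|rewrite add0r scale1r|rewrite add0r mul1r].
  move=> [y u] Mp; exists (y, u), 0; split => //=; first by left.
    by rewrite scale0r addr0.
  by rewrite mul0r addr0.
split.
- move=> z1 t1 z2 t2 [[y1 u1] [s1 [+ s10 /= -> ->]]].
  move=> + [[y2 u2] [s2 [+ s20 /= -> ->]]] => My1 My2.
  exists (y1 + y2, u1 + u2), (s1 + s2); split => /=; last 3 first.
  + exact: addr_ge0.
  + by rewrite scalerDl addrACA.
  + by rewrite mulrDl addrACA.
  case: My1 My2 => [My1|[-> ->]] [My2|[-> ->]]; rewrite ?addr0 ?add0r;
    by [left; exact: MD|left|right].
- move=> s y u s0 [[y1 u1] [s1 [+ s10 /= -> ->]]] => My1.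
  exists (s *: y1, s * u1), (s * s1); split => /=; last 3 first.
  + exact/mulr_ge0/s10/ltW.
  + by rewrite scalerDr scalerA.
  + by rewrite mulrDr mulrA.
  case: My1 => [My1|[-> ->]]; last by right; rewrite scaler0 mulr0.
  by left; exact: MZ.
- move=> u [[y1 u1] [s [+ s0 /= y1z u1E]]].
  rewrite le_eqVlt in s0; case/predU1P: s0 => [s0|s0].
    move: y1z u1E; rewrite -s0 scale0r mul0r !addr0 => <- ->.
    by case=> [/M0//|[->]].
  case=> [My1|[y10 _]]; last first.
    move/eqP: y1z; rewrite y10 add0r eq_sym scaler_eq0 (negbTE z0) orbF.
    by rewrite gt_eqF.
  rewrite leNgt; apply/negP => u0; apply: nN; exists (s^-1 * u1).
    rewrite -ltr_pdivlMl ?invr_gt0// invrK mulrN; lra.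
  have -> : - z = s^-1 *: y1.
    move/eqP: y1z; rewrite eq_sym addr_eq0 => /eqP ->.
    by rewrite scalerN scalerA mulVf ?gt_eqF// scale1r.
  by apply: MZ => //; rewrite invr_gt0.
Qed.

(** The cone generated by [S] extends to a maximal one, whose lower boundary [L z] is sublinear. The
    dichotomy for maximal cones makes [L] odd, hence linear. *)
Lemma hahn_banach_epigraph (S : set (E * R)) :
  (forall (a : R) z1 t1 z2 t2, 0 <= a <= 1 -> S (z1, t1) -> S (z2, t2) ->
    S (a *: z1 + (1 - a) *: z2, a * t1 + (1 - a) * t2)) ->
  (forall z, exists t, S (z, t)) ->
  (forall t, S (0, t) -> 0 <= t) ->
  exists2 L : E -> R, (forall (a : R) x y, L (a *: x + y) = a * L x + L y) &
    forall z t, S (z, t) -> L z <= t.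
Proof.
move=> cvxS domS S0.
pose C := [set p : E * R | exists2 s : R, 0 < s & S (s *: p.1, s * p.2)].
have coneC : proper_cone C.
  split.
  - move=> z1 t1 z2 t2 [s1 s10 /= S1] [s2 s20 /= S2].
    have s120 : 0 < s1 + s2 by exact: addr_gt0.
    (* This weight [a] solves [a * s1 = (1 - a) * s2], so the combination is a common multiple of
       [z1 + z2]. *)
    have a1 : 0 <= s2 / (s1 + s2) <= 1.
      rewrite divr_ge0 ?(ltW s20) ?(ltW s120)//=.
      rewrite ler_pdivrMr// mul1r; lra.
    exists (s1 * s2 / (s1 + s2)); first by rewrite divr_gt0 ?mulr_gt0.
    have := cvxS _ _ _ _ _ a1 S1 S2.
    have -> : 1 - s2 / (s1 + s2) = s1 / (s1 + s2) by field; rewrite gt_eqF.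
    rewrite !scalerA /= => H; rewrite scalerDr mulrDr.
    congr S: H; congr pair.
      by congr (_ *: _ + _ *: _); field; rewrite gt_eqF.
    by rewrite !mulrA; congr (_ * _ + _ * _); field; rewrite gt_eqF.
  - move=> s z t s0 [r r0 /= Sr]; exists (r / s); first exact: divr_gt0.
    rewrite /= scalerA; congr S: Sr; congr pair; last by field; rewrite gt_eqF.
    by congr (_ *: _); field; rewrite gt_eqF.
  - move=> t [s s0 /=]; rewrite scaler0 => /S0.
    by rewrite pmulr_rge0.
have [M [CM coneM maxM]] := maximal_proper_cone _ coneC.
have SM : S `<=` M.
  by move=> [z t] Sz; apply: CM; exists 1 => //=; rewrite scale1r mul1r.
have domM z : exists t, M (z, t) by have [t /SM ?] := domS z; exists t.
have dich z t := @maximal_cone_dichotomy M z t coneM maxM.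
case: coneM => MD MZ M0.
pose L z := inf [set t | M (z, t)].
have lbM z : has_lbound [set t | M (z, t)].
  have [u Mu] := domM (- z); exists (- u) => t /= Mt.
  by have := MD _ _ _ _ Mt Mu; rewrite subrr => /M0; lra.
have LM z t : M (z, t) -> L z <= t by move=> Mt; exact: ge_inf.
have leL z c : (forall t, M (z, t) -> c <= t) -> c <= L z.
  move=> H; apply: lb_le_inf; first by have [t Mt] := domM z; exists t.
  by move=> t /=; exact: H.
have LD x y : L (x + y) <= L x + L y.
  rewrite -lerBlDr; apply: (leL) => t Mt; rewrite lerBlDr -lerBlDl.
  by apply: (leL) => u Mu; rewrite lerBlDl; apply/LM/MD.
have LZle (s : R) z : 0 < s -> L (s *: z) <= s * L z.
  move=> s0; rewrite -ler_pdivrMl//; apply: (leL) => t Mt.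
  by rewrite ler_pdivrMl//; apply/LM/MZ.
have LZ (s : R) z : 0 < s -> L (s *: z) = s * L z.
  move=> s0; apply/eqP; rewrite eq_le LZle//= -ler_pdivlMl//.
  have := LZle s^-1 (s *: z); rewrite scalerA mulVf ?gt_eqF// scale1r.
  by apply; rewrite invr_gt0.
have L0 : L 0 = 0.
  have := LZ 2 0 (ltr0n _ 2); rewrite scaler0; lra.
have LN z : L (- z) = - L z.
  have [->|z0] := eqVneq z 0; first by rewrite oppr0 L0 oppr0.
  have LzN : 0 <= L z + L (- z) by rewrite -L0 -(subrr z).
  apply/eqP; rewrite eq_le; apply/andP; split; last by lra.
  rewrite leNgt; apply/negP => LNz.
  (* The midpoint of [- L (- z)] and [L z]: either branch of the dichotomy at this height
     contradicts one of the two infima. *)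
  pose t := (L z - L (- z)) / 2.
  have tL : t < L z by rewrite /t; lra.
  have [/LM|[u ut /LM]] := dich z t z0; first by rewrite leNgt tL.
  rewrite /t in ut *; lra.
exists L; last by move=> z t /SM /LM.
have LDE x y : L (x + y) = L x + L y.
  apply/eqP; rewrite eq_le LD/=.
  have := LD (x + y) (- y); rewrite addrK LN; lra.
move=> a x y; rewrite LDE; congr (_ + _).
have [a0|a0|->] := ltgtP a 0; last by rewrite scale0r mul0r L0.
  by rewrite -{1}(opprK a) scaleNr LN LZ ?oppr_gt0// mulNr opprK.
exact: LZ.
Qed.

End hahn_banach.

(** * The dual space: bounded functionals and completeness *)

Section dual.
Context (R : realType) (X : normedModType R).
Implicit Types (eta zeta : dual_space X) (x y : X).

Lemma dual_addE eta zeta x : (eta + zeta) x = eta x + zeta x.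
Proof. by []. Qed.

Lemma dual_oppE eta x : (- eta) x = - eta x.
Proof. by []. Qed.

Lemma dual_scaleE (a : R) eta x : (a *: eta) x = a * eta x.
Proof. by []. Qed.

Lemma dualD eta x y : eta (x + y) = eta x + eta y.
Proof. by have := dual_linear eta 1 x y; rewrite !scale1r. Qed.

Lemma dualN eta x : eta (- x) = - eta x.
Proof. by rewrite -scaleN1r dualZ mulN1r. Qed.

Lemma dual_normM eta x : `|eta x| <= `|eta| * `|x|.
Proof.
have [->|x0] := eqVneq x 0.
  by rewrite -(scale0r 0) dualZ mul0r !normr0 scale0r normr0 mulr0.
have nx0 : 0 < `|x| by rewrite normr_gt0.
rewrite -ler_pdivrMr//.
have -> : `|eta x| / `|x| = `|eta (`|x|^-1 *: x)|.
  by rewrite dualZ normrM normfV normr_id mulrC.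
by apply: dual_norm_ub; rewrite normrZ normfV normr_id mulVf ?gt_eqF.
Qed.

(** A one-sided bound suffices because [L] is odd. *)
Lemma dual_of_bounded (L : X -> R) (M : R) :
  (forall (a : R) x y, L (a *: x + y) = a * L x + L y) ->
  (forall x, L x <= M * `|x|) ->
  exists eta, forall x, eta x = L x.
Proof.
move=> linL LM.
pose l := @GRing.isLinear.Build R X R^o *%R L linL.
pose g : {linear X -> R^o} := HB.pack (L : X -> R^o) l.
have LN x : L (- x) = - L x.
  have L0 : L 0 = 0 by have := linL (-1) 0 0; rewrite scaler0 addr0; lra.
  by have := linL (-1) x 0; rewrite scaleN1r addr0 L0; lra.
have cL : continuous (L : X -> R^o).
  apply: (@bounded_linear_continuous _ _ _ g); apply/bounded_funP => r.
  exists (`|M| * r) => x xr.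
  apply: (@le_trans _ _ (M * `|x|)).
    by rewrite ler_norml LM lerNl -LN -(normrN x) LM.
  apply: (@le_trans _ _ (`|M| * `|x|)).
    by rewrite ler_wpM2r// ler_norm.
  by rewrite ler_wpM2l.
have LP : (L : X -> R^o) \in @continuous_linear R X.
  by apply/asboolP; split.
by exists (Dual LP).
Qed.

(** The limit is taken pointwise; it is linear, and bounded because [F] contains a ball of radius 1.
    Completeness is what lets the Baire theorem be applied on the dual. *)
Lemma dual_cauchy_cvg (F : set_system (dual_space X)) :
  ProperFilter F -> cauchy F -> cvg F.
Proof.
move=> FF /cauchyP Fc.
have ballE eta e zeta x : ball eta e zeta -> `|eta x - zeta x| <= e * `|x|.
  rewrite -ball_normE /= => /ltW ez.
  by apply: le_trans (dual_normM (eta - zeta) x) _; rewrite ler_wpM2r.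
have evc x : cvg ((fun eta : dual_space X => eta x : R) @ F).
  apply/cauchy_cvgP/cauchy_exP => e e0.
  have e'0 : 0 < e / (`|x| + 1) by rewrite divr_gt0// ltr_wpDl.
  have [eta Feta] := Fc _ e'0; exists (eta x).
  suff : F [set zeta | ball (eta x : R) e (zeta x)] by [].
  apply: filterS Feta => zeta /(ballE _ _ _ x) /= ez.
  rewrite -ball_normE /=; apply: (le_lt_trans ez).
  by rewrite mulrAC ltr_pdivrMr ?ltr_wpDl// ltr_pM2l// ltrDl.
pose L x : R := lim ((fun eta : dual_space X => eta x : R) @ F).
have linL (a : R) x y : L (a *: x + y) = a * L x + L y.
  apply/cvg_lim => //.
  have -> : (fun eta : dual_space X => eta (a *: x + y) : R) =
      (fun eta => a * eta x + eta y).
    by apply/funext => eta; rewrite dualD dualZ.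
  apply: cvgD; last exact: evc.
  by apply: cvgMr; exact: evc.
have Lball eta e x : F (ball eta e) -> `|eta x - L x| <= e * `|x|.
  move=> Fe; rewrite ler_distlC; apply/andP; split.
    apply: limr_ge; first exact: evc.
    by apply: filterS Fe => zeta /(ballE _ _ _ x); rewrite ler_distlC => /andP[].
  apply: limr_le; first exact: evc.
  by apply: filterS Fe => zeta /(ballE _ _ _ x); rewrite ler_distlC => /andP[].
have [eta1 Feta1] := Fc 1 ltr01.
have [eta0 eta0E] : exists eta, forall x, eta x = L x.
  apply: (@dual_of_bounded L (1 + `|eta1|)) => // x.
  have := Lball _ _ x Feta1; have := dual_normM eta1 x.
  rewrite ler_norml ler_distl mulrDl => /andP[_ ?] /andP[? ?]; lra.
apply/cvg_ex; exists eta0; apply/cvg_ballP => e e0.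
have [eta Feta] := Fc (e / 2) (divr_gt0 e0 (ltr0n _ 2)).
apply: filterS (Feta) => zeta; rewrite -ball_normE /= => etaz.
rewrite -(subrKA eta) (splitr e).
apply: (le_lt_trans (ler_normD _ _)); apply: ler_ltD => //.
apply: dual_norm_le => x x1; rewrite dual_addE dual_oppE eta0E distrC.
apply: (le_trans (Lball _ _ x Feta)).
by rewrite ler_piMr// ltW// divr_gt0.
Qed.

HB.instance Definition _ := Uniform_isComplete.Build (dual_space X)
  dual_cauchy_cvg.

End dual.

(* Baire category: some sublevel set of [h] contains a ball, on which [L] is
   then bounded above. *)
Lemma linear_le_closed_sublevels_bounded (R : realType)
    (E : completeNormedModType R) (L h : E -> R) :
  (forall (a : R) x y, L (a *: x + y) = a * L x + L y) ->
  (forall x, L x <= h x) -> (forall c : R, closed [set x | h x <= c]) ->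
  exists M, forall x, L x <= M * `|x|.
Proof.
move=> linL Lh hcl.
pose O n := ~` [set x | h x <= n%:R].
have openO n : open (O n) by exact: closed_openC.
have [n ndO] : exists n, ~ dense (O n).
  apply/existsNP => dO.
  have := @Baire _ _ _ (fun n => conj (openO n) (dO n)).
  move=> /(_ setT); rewrite setTI => /(_ _ openT)[|x /= Ox]; first by exists 0.
  apply: (Ox (Num.truncn (h x)).+1 Logic.I) => /=.
  by apply/ltW; rewrite truncnS_gt.
have [D [[x0 xD] DO]] := denseNE ndO.
have [r r0 xrD] : exists2 r : R, 0 < r & ball x0 r `<=` D.
  by have /nbhs_ballP := open_nbhs_nbhs xD.
have Lr x : ball x0 r x -> L x <= n%:R.
  move=> xr; apply: (le_trans (Lh x)); apply: contrapT => hxn.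
  suff : (D `&` O n) x by rewrite DO.
  by split => //; exact: xrD.
have L0 : L 0 = 0 by have := linL (-1) 0 0; rewrite scaler0 addr0; lra.
exists ((n%:R - L x0) * 2 / r) => x.
have [->|xn0] := eqVneq x 0; first by rewrite L0 normr0 mulr0.
have nx0 : 0 < `|x| by rewrite normr_gt0.
(* [s *: x] has norm [r / 2], so [s *: x + x0] stays in the ball where [L] is at most [n]. *)
pose s := r / 2 / `|x|.
have s0 : 0 < s by rewrite /s !divr_gt0.
have /Lr : ball x0 r (s *: x + x0).
  rewrite -ball_normE /= opprD addrC subrK normrN normrZ gtr0_norm//.
  rewrite /s divfK ?gt_eqF//; lra.
rewrite linL -lerBrDr -ler_pdivlMl// => /le_trans; apply.
rewrite le_eqVlt; apply/orP; left; apply/eqP; rewrite /s.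
by field; rewrite !gt_eqF.
Qed.

(** * Subgradients, Gateaux derivatives and continuity of minorants *)

Section subgradients.
Context {R : realType}.

Definition subgradient {V : normedModType R} (g : V -> R) (u : V)
    (eta : dual_space V) : Prop :=
  forall v, g u + eta (v - u) <= g v.

Definition subdifferentiable {V : normedModType R} (g : V -> R) : Prop :=
  forall u, exists eta, subgradient g u eta.

(** The derivative is also the right-hand limit of the difference quotients, so a bound for small
    positive [h] is enough. *)
Lemma derive_le {V : normedModType R} {g : V -> R} {u v} {l c : R} :
  is_derive u v (g : V -> R^o) l ->
  (forall h : R, 0 < h < 1 -> g (h *: v + u) - g u <= h * c) -> l <= c.
Proof.
move=> [dg <-] gc; rewrite /derive.
rewrite (cvg_at_rightE _ _ dg); apply: limr_le.
  apply: cvgP; apply: cvg_trans dg; apply: cvg_app; move=> A A0.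
  suff : \forall h \near (0 : R), 0 < h -> A h by [].
  by apply: filterS (A0 : \forall h \near (0 : R), h != 0 -> A h) => h + h0;
    apply; rewrite gt_eqF.
near=> h.
have h0 : 0 < h by near: h; exact: nbhs_right_gt.
have h1 : h < 1 by near: h; exact: nbhs_right_lt.
have := gc h; rewrite h0 h1 => /(_ isT).
by rewrite -ler_pdivrMl.
Unshelve. all: by end_near.
Qed.

Lemma gateaux_subgradient {V : normedModType R} {g : V -> R} {u eta} :
  (forall (a : R) x y, 0 <= a <= 1 ->
    g (a *: x + (1 - a) *: y) <= a * g x + (1 - a) * g y) ->
  is_gateaux g u eta -> subgradient g u eta.
Proof.
move=> cvx gu v; rewrite -lerBrDl.
apply: (derive_le (gu (v - u))) => h /andP[h0 h1].
have hb : 0 <= h <= 1 by rewrite !ltW.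
have := cvx h v u hb.
have -> : h *: v + (1 - h) *: u = h *: (v - u) + u.
  by rewrite scalerBr scalerBl scale1r -addrA; congr (_ + _); rewrite addrC.
by lra.
Qed.

(** The subgradient inequality bounds [eta] by the derivative in every direction; opposite
    directions give equality. *)
Lemma subgradient_gateaux {V : normedModType R} {g : V -> R} {u eta zeta} :
  subgradient g u eta -> is_gateaux g u zeta -> eta = zeta.
Proof.
move=> sg gu; apply: val_inj; apply/funext => v /=.
have le w : eta w <= zeta w.
  rewrite -lerN2; apply: (derive_le (is_deriveN (gu w))) => h _ /=.
  have := sg (h *: w + u); rewrite addrK dualZ.
  by rewrite !fctE; lra.
change (eta v = zeta v); apply/eqP; rewrite eq_le le /=.
by rewrite -lerN2 -!dualN.
Qed.

(** The subgradient inequalities at the combined point are averaged; their linear terms cancel. *)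
Lemma subdifferentiable_convex {V : normedModType R} {g : V -> R} :
  subdifferentiable g -> forall (a : R) x y, 0 <= a <= 1 ->
    g (a *: x + (1 - a) *: y) <= a * g x + (1 - a) * g y.
Proof.
move=> sg a x y /andP[a0 a1].
set z := a *: x + _; have [eta etaz] := sg z.
have H : a *: (x - z) + (1 - a) *: (y - z) = 0.
  by rewrite !scalerBr addrACA -opprD -scalerDl (addrC a) subrK scale1r subrr.
have := congr1 eta H; rewrite dualD !dualZ -[in eta 0](scale0r 0) dualZ mul0r.
have := ler_wpM2l a0 (etaz x); have := ler_wpM2l _ (etaz y).
move=> /(_ (1 - a)); rewrite subr_ge0 => /(_ a1).
lra.
Qed.

(** [g] is the supremum of its continuous affine minorants, so the sublevel set is an intersection
    of closed sets. *)
Lemma subdifferentiable_closed {V : normedModType R} {g : V -> R} (c : R) :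
  subdifferentiable g -> closed [set x | g x <= c].
Proof.
move=> sg.
have -> : [set x | g x <= c] =
    \bigcap_(p in [set p : V * dual_space V | subgradient g p.1 p.2])
      [set x | g p.1 + p.2 (x - p.1) <= c].
  apply/seteqP; split => [x /= gx [u eta] /= etau|x H].
    exact: le_trans (etau x) gx.
  have [eta etax] := sg x; have := H (x, eta) etax.
  by rewrite /= subrr -(scale0r 0) dualZ mul0r addr0.
apply: closed_bigI => -[u eta] _ /=.
apply: (@closed_comp _ _ (fun x => g u + eta (x - u)) [set r | r <= c]);
  last exact: closed_le.
move=> x _; apply: cvgD; first exact: cvg_cst.
apply: (@continuous_comp _ _ _ (fun x => x - u) eta).
  by apply: cvgB; [exact: cvg_id|exact: cvg_cst].
exact: dual_continuous.
Qed.

(** The bound [c + g (z0 - x)] is the form in which the value function is controlled along one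
    factor of the product. *)
Lemma linear_le_subdifferentiable {E : completeNormedModType R} {L g : E -> R}
    (c : R) (z0 : E) :
  (forall (a : R) x y, L (a *: x + y) = a * L x + L y) ->
  subdifferentiable g -> (forall x, L x <= c + g (z0 - x)) ->
  exists eta : dual_space E, forall x, eta x = L x.
Proof.
move=> linL sg Lg.
have sh : subdifferentiable (fun x => c + g (z0 - x)).
  move=> u; have [eta etau] := sg (z0 - u); exists (- eta) => v.
  have := etau (z0 - v).
  have -> : z0 - v - (z0 - u) = - (v - u) by rewrite !opprB addrC subrKA.
  by rewrite dualN dual_oppE; lra.
have [M LM] := linear_le_closed_sublevels_bounded _ _ _ _ linL Lg
  (fun c => subdifferentiable_closed c sh).
exact: dual_of_bounded linL LM.
Qed.

(** A linear minorant of the convex function sending [z] to [|z + d| - |d|] is continuous and takes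
    a value at most [- |d|] at [- d]. *)
Lemma dual_separates {V : normedModType R} (d : V) :
  (forall eta : dual_space V, eta d = 0) -> d = 0.
Proof.
move=> d0.
pose S := [set p : V * R | `|p.1 + d| - `|d| <= p.2].
have [|||L linL LS] := @hahn_banach_epigraph R V S.
- move=> a z1 t1 z2 t2 /andP[a0 a1]; rewrite /S /= => H1 H2.
  have -> : a *: z1 + (1 - a) *: z2 + d = a *: (z1 + d) + (1 - a) *: (z2 + d).
    by rewrite !scalerDr addrACA -scalerDl (addrC a) subrK scale1r.
  have := ler_normD (a *: (z1 + d)) ((1 - a) *: (z2 + d)).
  rewrite !normrZ (ger0_norm a0) ger0_norm ?subr_ge0//.
  have := ler_wpM2l a0 H1; have := ler_wpM2l _ H2.
  move=> /(_ (1 - a)); rewrite subr_ge0 => /(_ a1).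
  lra.
- by move=> z; exists (`|z + d| - `|d|); rewrite /S /=.
- by move=> t; rewrite /S /= add0r subrr.
have L0 : L 0 = 0 by have := linL (-1) 0 0; rewrite scaler0 addr0; lra.
have [|eta etaL] := @dual_of_bounded R V L 1 linL.
  move=> x; apply: LS; rewrite /S /= mul1r.
  by have := ler_normD x d; lra.
have := LS (- d) (- `|d|); rewrite /S /= addNr normr0 sub0r lexx => /(_ isT).
rewrite -etaL dualN d0 oppr0 oppr_ge0 normr_le0 => /eqP //.
Qed.

End subgradients.

(** * Convex conjugates *)

Section conjugate.
Context {R : realType} {X : normedModType R}.
Implicit Types (f : X -> R) (fs : dual_space X -> R).

(** The universal property of the supremum, which keeps the conjugate real-valued. *)
Definition conjugate_function f fs : Prop :=
  forall (eta : dual_space X) c, fs eta <= c <-> forall v, eta v - f v <= c.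

Lemma fenchel_young {f fs} : conjugate_function f fs ->
  forall (eta : dual_space X) v, eta v - f v <= fs eta.
Proof. by move=> ffs eta; apply/ffs. Qed.

Lemma conjugate_function_fine f :
  (forall eta, convex_conjugate (EFin \o f) eta \is a fin_num) ->
  conjugate_function f (fine \o convex_conjugate (EFin \o f)).
Proof.
move=> fin eta c; rewrite /= -lee_fin fineK//; split => [H v|H].
  rewrite -lee_fin; apply: le_trans H; apply: ereal_sup_ubound.
  by exists v => //; rewrite /= EFinB.
by apply: ge_ereal_sup => _ [v _ <-]; rewrite /= -EFinB lee_fin.
Qed.

Lemma conjugate_function_convex {f fs} : conjugate_function f fs ->
  forall (a : R) eta zeta, 0 <= a <= 1 ->
    fs (a *: eta + (1 - a) *: zeta) <= a * fs eta + (1 - a) * fs zeta.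
Proof.
move=> ffs a eta zeta /andP[a0 a1]; apply/ffs => v.
rewrite dual_addE !dual_scaleE.
have := ler_wpM2l a0 (fenchel_young ffs eta v).
have := ler_wpM2l _ (fenchel_young ffs zeta v).
move=> /(_ (1 - a)); rewrite subr_ge0 => /(_ a1).
lra.
Qed.

(* A subgradient [eta] of [f] at [y] makes [y] a subgradient of the conjugate
   at [eta], and the latter is differentiable there. *)
Lemma subgradient_inj {f fs} : conjugate_function f fs ->
  (forall eta, exists F, is_gateaux fs eta F) ->
  forall eta y1 y2, subgradient f y1 eta -> subgradient f y2 eta -> y1 = y2.
Proof.
move=> ffs dfs eta y1 y2 sg1 sg2.
have [F dF] := dfs eta.
(* The derivative of [fs] at [eta] is evaluation at any such [y], so [y1] and [y2] agree under every
   functional. *)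
have FE y : subgradient f y eta -> forall zeta, F zeta = zeta y.
  move=> sg.
  have [||G GE] := @dual_of_bounded R (dual_space X) (fun zeta => zeta y) `|y|.
  - by move=> a zeta1 zeta2; rewrite dual_addE dual_scaleE.
  - by move=> zeta; rewrite mulrC (le_trans (ler_norm _))// dual_normM.
  move=> zeta; rewrite -GE; congr (dual_fun _ zeta); apply/esym.
  apply: (subgradient_gateaux _ dF) => zeta'.
  rewrite GE dual_addE dual_oppE.
  have : fs eta <= eta y - f y.
    by apply/ffs => v; have := sg v; rewrite dualD dualN; lra.
  by have := fenchel_young ffs zeta' y; lra.
apply/eqP; rewrite -subr_eq0; apply/eqP; apply: dual_separates => zeta.
by rewrite dualD dualN -(FE y1)// -(FE y2)// subrr.
Qed.

End conjugate.

(** * Surjectivity through the Fitzpatrick function *)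

Section sum_range.
Context {R : realType} {X : completeNormedModType R}.
Variable X_reflexive : reflexive_space X.
Variables (f : X -> R) (fs : dual_space X -> R).
Hypothesis f_subdiff : subdifferentiable f.
Hypothesis fs_subdiff : subdifferentiable fs.
Hypothesis f_fs : conjugate_function f fs.
Variable B : X -> set (dual_space X).
Hypothesis B_mono : monotone_operator B.
Hypothesis B_max : forall u us,
  (forall a as_, B a as_ -> 0 <= (us - as_) (u - a)) -> B u us.

(* The epigraph of the Fitzpatrick function of [B]. *)
Let fitz (u : X) (us : dual_space X) (t : R) : Prop :=
  forall a as_, B a as_ -> as_ u + us a - as_ a <= t.

(** If [t < us u], then [(u, us)] is monotonically related to [B], hence lies in [B], and testing
    [fitz] at that very pair is contradictory. *)
Let fitz_ge u us t : fitz u us t -> us u <= t.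
Proof.
move=> tfitz; rewrite leNgt; apply/negP => tu.
have /tfitz : B u us.
  apply: B_max => a as_ /tfitz; rewrite dualD dualN !dual_addE !dual_oppE; lra.
lra.
Qed.

Let fitz_mem a as_ : B a as_ -> fitz a as_ (as_ a).
Proof.
move=> Ba b bs Bb; have := B_mono _ _ _ _ Ba Bb.
rewrite dualD dualN !dual_addE !dual_oppE; lra.
Qed.

Lemma subgradient_sum_zero : exists u us, B u us /\ subgradient f u (- us).
Proof.
have [a0 [as0 B0]] : exists a as_, B a as_.
  apply: contrapT => nB; apply: (nB); exists 0, 0; apply: B_max => a as_ Ba.
  by exfalso; apply: nB; exists a, as_.
(* [p.1] is the perturbation in the value function; [u], [us] and [t] are the variables minimised
   over. *)
pose S := [set p : (X * dual_space X) * R | exists u us t,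
  fitz u us t /\ t + f (u - p.1.1) + fs (p.1.2 - us) <= p.2].
have [|||L linL LS] := @hahn_banach_epigraph R (X * dual_space X)%type S.
- move=> a [z1 zs1] r1 [z2 zs2] r2 a01 [u1 [us1 [t1 [fz1 le1]]]].
  move=> [u2 [us2 [t2 [fz2 le2]]]]; case/andP: (a01) => a0_ a1_.
  exists (a *: u1 + (1 - a) *: u2), (a *: us1 + (1 - a) *: us2),
    (a * t1 + (1 - a) * t2); split.
    move=> b bs Bb; rewrite dualD !dualZ dual_addE !dual_scaleE.
    have := ler_wpM2l a0_ (fz1 _ _ Bb); have := ler_wpM2l _ (fz2 _ _ Bb).
    move=> /(_ (1 - a)); rewrite subr_ge0 => /(_ a1_); lra.
  have combo (V : lmodType R) (p1 p2 q1 q2 : V) :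
      a *: p1 + (1 - a) *: p2 - (a *: q1 + (1 - a) *: q2) =
      a *: (p1 - q1) + (1 - a) *: (p2 - q2).
    by rewrite opprD addrACA -!scalerBr.
  rewrite /= !combo.
  have := subdifferentiable_convex f_subdiff a (u1 - z1) (u2 - z2) a01.
  have := conjugate_function_convex f_fs a (zs1 - us1) (zs2 - us2) a01.
  have := ler_wpM2l a0_ le1; have := ler_wpM2l _ le2.
  move=> /(_ (1 - a)); rewrite subr_ge0 => /(_ a1_) /=; lra.
- move=> z; exists (as0 a0 + f (a0 - z.1) + fs (z.2 - as0)).
  by exists a0, as0, (as0 a0); split => //; exact: fitz_mem.
- move=> r [u [us [t [/fitz_ge ut]]]]; rewrite /= subr0 sub0r.
  by have := fenchel_young f_fs (- us) u; rewrite dual_oppE; lra.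
(* Freezing the base point at [(a0, as0)] bounds [L (z, 0)] by a constant plus [f (a0 - z)]. *)
have [us usE] : exists us : dual_space X, forall z, us z = L (z, 0).
  apply: (linear_le_subdifferentiable (as0 a0 + fs (- as0)) a0 _ f_subdiff).
    by move=> a x y; rewrite -linL; congr L; apply: injective_projections;
      rewrite /= ?scaler0 ?addr0.
  move=> z; apply: LS; exists a0, as0, (as0 a0); split; first exact: fitz_mem.
  by rewrite /= sub0r; lra.
(* On the second factor the bound involves [fs (z - as0)], so [fs] is reflected to fit the form
   [g (as0 - z)]. *)
have [F FE] : exists F : dual_space (dual_space X), forall z, F z = L (0, z).
  apply: (linear_le_subdifferentiable (E := dual_space X)
    (as0 a0 + f a0) as0 _ (g := fun z => fs (- z)) _).
  - by move=> a x y; rewrite -linL; congr L; apply: injective_projections;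
      rewrite /= ?scaler0 ?addr0.
  - move=> eta; have [G sgG] := fs_subdiff (- eta); exists (- G) => zeta.
    have := sgG (- zeta); rewrite opprK (addrC (- zeta)).
    by rewrite dual_oppE -dualN opprB.
  move=> z; apply: LS; exists a0, as0, (as0 a0); split; first exact: fitz_mem.
  by rewrite /= opprB subr0.
have [u uE] := X_reflexive F.
(* The perturbation [(a - v, as_ + vs)] at base point [(a, as_)] leaves exactly [f v] and [fs vs],
   with [v] and [vs] free. *)
have key v (vs : dual_space X) a as_ : B a as_ ->
    us a - us v + (as_ u + vs u) <= as_ a + f v + fs vs.
  move=> Ba; have := LS (a - v, as_ + vs) (as_ a + f v + fs vs).
  have -> : L (a - v, as_ + vs) = us (a - v) + (as_ + vs) u.
    rewrite usE -uE FE -[L (a - v, 0)]mul1r -linL; congr L.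
    by rewrite scale1r; apply: injective_projections; rewrite /= ?addr0 ?add0r.
  rewrite dualD dualN dual_addE; apply.
  exists a, as_, (as_ a); split; first exact: fitz_mem.
  by rewrite /= subKr (addrC as_ vs) addrK.
(* For a subgradient [vs] at [u], [vs u - fs vs] is at least [f u], which eliminates [vs] from
   [key]. *)
have [vs vsu] := f_subdiff u.
have fsvs : fs vs <= vs u - f u.
  by apply/f_fs => v; have := vsu v; rewrite dualD dualN; lra.
have fs_us a as_ : B a as_ -> fs (- us) <= as_ a - us a - as_ u - f u.
  move=> /key keya; apply/f_fs => v; have := keya v vs.
  by rewrite dual_oppE; lra.
(* [fs_us] says that the Fitzpatrick function at [(u, us)] is at most [- f u - fs (- us)]; this
   yields the reverse of the Fenchel-Young inequality. *)
have fsle : fs (- us) <= - us u - f u.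
  have /fitz_ge : fitz u us (- f u - fs (- us)); last by lra.
  by move=> a as_ /fs_us; lra.
exists u, us; split.
  apply: B_max => a as_ /fs_us.
  have := fenchel_young f_fs (- us) u.
  rewrite dualD dualN !dual_addE !dual_oppE; lra.
move=> v; have := fenchel_young f_fs (- us) v.
by rewrite dualD dualN !dual_oppE; lra.
Qed.

End sum_range.

(** * The resolvent: existence and uniqueness *)

Section resolvent.
Context {R : realType} {X : completeNormedModType R}.
Variable X_reflexive : reflexive_space X.

(** Otherwise adjoining [(u, us)] to the graph would give a proper monotone extension. *)
Lemma maximally_monotone_mem {A : X -> set (dual_space X)} {u us} :
  maximally_monotone A ->
  (forall a as_, A a as_ -> 0 <= (us - as_) (u - a)) -> A u us.
Proof.
move=> [monoA maxA] rel; apply: contrapT => nA.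
pose B x := A x `|` [set xs | x = u /\ xs = us].
apply: (maxA B); last first.
  split; first by move=> [x xs] /= Ax; left.
  by move=> /(_ (u, us)) BA; apply/nA/BA; right.
move=> x1 x2 xs1 xs2 [A1|[-> ->]] [A2|[-> ->]]; first exact: monoA.
- have := rel _ _ A1.
  by rewrite !dualD !dualN !dual_addE !dual_oppE; lra.
- exact: rel.
- by rewrite !subrr.
Qed.

Lemma operator_scale_monotone {A : X -> set (dual_space X)} {l : R} :
  0 < l -> monotone_operator A -> monotone_operator (operator_scale l A).
Proof.
move=> l0 monoA x1 x2 _ _ [xs1 A1 <-] [xs2 A2 <-].
rewrite -scalerBr dual_scaleE; apply: mulr_ge0; [exact: ltW|exact: monoA].
Qed.

Lemma fully_legendre_gradient {f : X -> R} : fully_legendre f ->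
  forall u, is_gateaux f u (gateaux_gradient f u).
Proof.
move=> [_ _ [_ df] _] u; have [eta etaP] := df u.
exact: (@xgetPex _ _ [set eta | is_gateaux f u eta] (ex_intro _ eta etaP)).
Qed.

Lemma fully_legendre_subgradient {f : X -> R} : fully_legendre f ->
  forall u, subgradient f u (gateaux_gradient f u).
Proof.
move=> fL u; apply: gateaux_subgradient; last exact: fully_legendre_gradient.
case: fL => _ cvxf _ _ a x y /andP[a0 a1].
exact: (cvxf (Itv01 a0 a1) x y (in_setT _) (in_setT _)).
Qed.

Lemma resolvent_exists {f : X -> R} {A : X -> set (dual_space X)} {l : R} w :
  fully_legendre f -> maximally_monotone A -> 0 < l ->
  exists y xi, A y xi /\ gateaux_gradient f y + l *: xi = w.
Proof.
move=> fL maxA l0.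
have [_ _ _ [fin dfs]] := fL.
have ffs := conjugate_function_fine f fin.
set fs := (fine \o convex_conjugate _) in dfs ffs.
have fsD : subdifferentiable fs.
  move=> eta; have [F dF] := dfs eta; exists F.
  exact: gateaux_subgradient (conjugate_function_convex ffs) dF.
(* Subtracting [w] from [f] moves the target to zero and translates the conjugate to
   [fs (eta + w)]. *)
have [y [_ [[xi Ay <-] sg]]] : exists u us,
    operator_scale l A u us /\ subgradient (fun v => f v - w v) u (- us).
  apply: (subgradient_sum_zero X_reflexive _ (fun eta => fs (eta + w))).
  - move=> u; exists (gateaux_gradient f u - w) => v.
    have := fully_legendre_subgradient fL u v.
    by rewrite !dual_addE !dual_oppE !dualD !dualN; lra.
  - move=> eta; have [F sF] := fsD (eta + w); exists F => zeta.
    by have := sF (zeta + w); rewrite opprD addrACA subrr addr0.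
  - move=> eta c; split => [/ffs H v|H].
      by have := H v; rewrite dual_addE; lra.
    by apply/ffs => v; have := H v; rewrite dual_addE; lra.
  - by apply: operator_scale_monotone => //; case: maxA.
  - move=> u us rel; exists (l^-1 *: us);
      last by rewrite scalerA divff ?gt_eqF// scale1r.
    apply: maximally_monotone_mem => // a as_ Aa.
    have := rel a (l *: as_) (ex_intro2 _ _ as_ Aa erefl).
    have -> : us - l *: as_ = l *: (l^-1 *: us - as_).
      by rewrite scalerBr scalerA divff ?gt_eqF// scale1r.
    by rewrite dual_scaleE pmulr_rge0.
exists y, xi; split => //.
suff -> : gateaux_gradient f y = w - l *: xi by rewrite subrK.
apply/esym/(subgradient_gateaux _ (fully_legendre_gradient fL y)) => v.
by have := sg v; rewrite !dual_addE !dual_oppE !dualD !dualN; lra.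
Qed.

Lemma resolvent_unique {f : X -> R} {A : X -> set (dual_space X)} {l : R}
    {y1 xi1 y2 xi2} :
  fully_legendre f -> monotone_operator A -> 0 < l -> A y1 xi1 -> A y2 xi2 ->
  gateaux_gradient f y1 + l *: xi1 = gateaux_gradient f y2 + l *: xi2 ->
  y1 = y2.
Proof.
move=> fL monoA l0 A1 A2 eq12.
have [_ _ _ [fin dfs]] := fL.
have sg1 := fully_legendre_subgradient fL y1.
have sg2 := fully_legendre_subgradient fL y2.
(* It remains to see that the gradient at [y2] is a subgradient at [y1]: by monotonicity of [A], the
   gradient difference pairs nonpositively with [y1 - y2]. *)
apply: (subgradient_inj (conjugate_function_fine f fin) dfs _ _ _ _ sg2) => v.
have mono := mulr_ge0 (ltW l0) (monoA _ _ _ _ A1 A2).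
have e12 z : gateaux_gradient f y1 z + l * xi1 z =
    gateaux_gradient f y2 z + l * xi2 z.
  by rewrite -!dual_scaleE -!dual_addE eq12.
have := sg2 v; have := sg1 y2; have := e12 y1; have := e12 y2; move: mono.
rewrite !dual_addE !dual_oppE !dualD !dualN; lra.
Qed.

(** Existence makes the chosen set nonempty, so [resolvent] is a genuine solution and not the
    default 0. *)
Lemma resolventP {f : X -> R} {A : X -> set (dual_space X)} {l : R} w :
  fully_legendre f -> maximally_monotone A -> 0 < l ->
  exists2 xi, A (resolvent f l A w) xi &
    gateaux_gradient f (resolvent f l A w) + l *: xi = w.
Proof.
move=> fL maxA l0; have [y [xi [Ay yw]]] := resolvent_exists w fL maxA l0.
have : operator_inv (operator_add (fun x => [set gateaux_gradient f x])
    (operator_scale l A)) w (resolvent f l A w).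
  apply: xgetPex; exists y, (gateaux_gradient f y) => //.
  by exists (l *: xi) => //; exists xi.
by move=> [_ -> [_ [xi' Axi' <-] wE]]; exists xi'.
Qed.

End resolvent.

(** * Solutions near the origin *)

Theorem proposition5p1 (R : realType) (X : completeNormedModType R)
    (X_reflexive : reflexive_space X)
    (f : X -> R) (f_legendre : fully_legendre f)
    (A : X -> set (dual_space X)) (A_maxmono : maximally_monotone A)
    (U : set (dual_space X)) (U_open : open U) (U0 : U 0)
    (Phi Psi : dual_space X -> dual_space X -> X -> X -> R)
    (x : X) (lambda : R) (lambda_gt0 : 0 < lambda) :
  let nabla_f : X -> dual_space X := gateaux_gradient f in
  let ytilde (eta : dual_space X) : X :=
    resolvent f lambda A (lambda *: eta + nabla_f x) in
  let xitilde (eta : dual_space X) : dual_space X :=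
    eta - lambda^-1 *: (nabla_f (ytilde eta) - nabla_f x) in
  let phi (eta : dual_space X) : R :=
    Phi eta (xitilde eta) x (ytilde eta) in
  let psi (eta : dual_space X) : R :=
    Psi eta (xitilde eta) x (ytilde eta) in
  let theta (eta : dual_space X) : R := psi eta - phi eta in
  let solution (eta : dual_space X) (y : X) (xi : dual_space X) : Prop :=
    [/\ A y xi,
        eta = xi + lambda^-1 *: (nabla_f y - nabla_f x) &
        Phi eta xi x y < Psi eta xi x y] in
  lower_semicontinuous_at_in U theta 0 ->
  0 < theta 0 ->
  exists2 r : R, 0 < r &
    forall eta : dual_space X, `|eta| < r ->
      [/\ U eta,
          exists! p : X * dual_space X, solution eta p.1 p.2 &
          forall y xi, solution eta y xi ->
            y = ytilde eta /\ xi = xitilde eta].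
move=> nabla_f ytilde xitilde phi psi theta solution lsc theta0.
have l0 : lambda != 0 by rewrite gt_eqF.
have tildeP eta : A (ytilde eta) (xitilde eta).
  have [xi Axi xiE] := resolventP X_reflexive (lambda *: eta + nabla_f x)
    f_legendre A_maxmono lambda_gt0.
  rewrite /xitilde /ytilde.
  congr (A _ _): Axi; apply: (scalerI l0).
  apply: (addrI (nabla_f (ytilde eta))); rewrite [LHS]xiE.
  rewrite scalerBr scalerA divff// scale1r opprB addrCA.
  by rewrite [X in _ = _ + X]addrC subrK.
have sol_uniq eta y xi : solution eta y xi -> y = ytilde eta /\ xi = xitilde eta.
  move=> [Ay etaE _].
  have yE : y = ytilde eta.
    apply: (resolvent_unique f_legendre (proj1 A_maxmono) lambda_gt0 Ay
      (tildeP eta)).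
    have etaE' : lambda *: eta = lambda *: xi + (nabla_f y - nabla_f x).
      by rewrite etaE scalerDr scalerA divff// scale1r.
    rewrite /xitilde scalerBr scalerA divff// scale1r etaE' opprB.
    by rewrite -[in RHS]addrA subrKA addrCA [X in _ = _ + X]addrC subrK addrC.
  by split=> //; rewrite /xitilde -yE [in RHS]etaE addrK.
(* Semicontinuity at level 0 holds only relative to [U]; openness of [U] turns it into a full
   neighbourhood, whose ball supplies [r]. *)
have /nbhs_ballP[r r0 rU] : nbhs (0 : dual_space X)
    (U `&` [set eta | 0 < theta eta]).
  have UN : nbhs (0 : dual_space X) U by exact: open_nbhs_nbhs.
  have := lsc 0 theta0; rewrite near_withinE => H.
  by apply: filterS2 UN H => eta Ueta thetaU; split => //; exact: thetaU.
exists r => // eta etar.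
have [Ueta theta_eta] : (U `&` [set eta | 0 < theta eta]) eta.
  by apply: rU; rewrite -ball_normE /= sub0r normrN.
have sol : solution eta (ytilde eta) (xitilde eta).
  split; first exact: tildeP.
    by rewrite /xitilde subrK.
  by rewrite -subr_gt0.
split => //; last exact: sol_uniq.
by exists (ytilde eta, xitilde eta); split => // -[y xi] /= /sol_uniq[-> ->].
Qed.
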